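(* For any finite nonempty sets $\mathcal{W}_1,\ldots,\mathcal{W}_n\subset\mathbb{R}^n$, $T(\mathcal{W}_1,\ldots,\mathcal{W}_n)\le\prod_{i=1}^n(|\mathcal{W}_i|-1)$; that is, the Kouchnirenko bound holds for the number of nondegenerate positive solutions of tropical polynomial systems (equivalently, of real polynomial systems obtained by combinatorial patchworking) with supports $\mathcal{W}_1,\ldots,\mathcal{W}_n$.
   Context: Let $P_i=\mathrm{conv}\,\mathcal{W}_i$. Given $\mu_i:\mathcal{W}_i\to\mathbb{R}$, let $\hat P_i=\mathrm{conv}\{(w,\mu_i(w))\}\subset\mathbb{R}^{n+1}$, $\hat P=\sum_i\hat P_i$; projecting the lower faces of $\hat P$ (faces where some $\langle u,\cdot\rangle$ with $u$ having positive last coordinate is minimized) gives the convex mixed subdivision $\mathcal{S}$ of $P=\sum P_i$, each $Q\in\mathcal{S}$ written $Q=Q_1+\cdots+Q_n$ with $Q_i$ the projection of the face of $\hat P_i$ where the same function is minimized; similarly $\mu_i$ alone gives the convex subdivision $\mathcal{S}_i$ of $P_i$. $\mathcal{S}$ is pure if $\dim Q=\sum\dim Q_i$ for all $Q\in\mathcal{S}$. A mixed polytope is $Q\in\mathcal{S}$ of dimension $n$ with each $Q_i$ a segment. Given sign maps $\sigma_i:\mathcal{W}_i\to\{+1,-1\}$, a mixed polytope is nonempty if for every $i$ the endpoints of $Q_i$ have opposite signs under $\sigma_i$. $T(\mathcal{W}_1,\ldots,\mathcal{W}_n)$ is the maximum, over all $\mu_i,\sigma_i$ such that each $\mathcal{S}_i$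 is a triangulation of $P_i$ with vertex set $\mathcal{W}_i$ and $\mathcal{S}$ is pure, of the number of nonempty mixed polytopes of $\mathcal{S}$. *)

(* Defs.v *)
From HB Require Import structures.
From mathcomp Require Import all_boot all_order all_algebra.
Set Implicit Arguments. Unset Strict Implicit. Unset Printing Implicit Defensive.
Import Order.TTheory GRing.Theory Num.Theory.
Local Open Scope ring_scope.

Section MixedSubdivision.
Variables (R : realFieldType) (n : nat).

Definition dotv (v w : 'rV[R]_n) : R := \sum_(j < n) v 0 j * w 0 j.

(* Points of W minimizing <(v,1),(w,mu w)> = <v,w> + mu w: these are the points
   of W whose lifts lie on the lower face of hat P_i cut out by u = (v,1);
   the projected face (cell) is conv of this list. *)
Definition argmin_set (W : seq 'rV[R]_n) (mu : 'rV[R]_n -> R) (v : 'rV[R]_n)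
  : seq 'rV[R]_n :=
  [seq w <- W | all (fun w' => dotv v w + mu w <= dotv v w' + mu w') W].

Definition seq_rank (s : seq 'rV[R]_n) : nat :=
  \rank (\matrix_(i < size s) nth 0 s i).

Definition dirs (A : seq 'rV[R]_n) : seq 'rV[R]_n := [seq a - head 0 A | a <- A].

Definition affdim (A : seq 'rV[R]_n) : nat := seq_rank (dirs A).

Definition aff_indep (A : seq 'rV[R]_n) : bool := affdim A == (size A).-1.

(* S_i (induced by mu on W) is a triangulation of conv W with vertex set W:
   every cell conv(argmin_set) is a simplex whose points of W are exactly
   its vertices, and every w in W is a 0-cell. *)
Definition is_triangulation (W : seq 'rV[R]_n) (mu : 'rV[R]_n -> R) : Prop :=
  (forall v, aff_indep (argmin_set W mu v)) /\
  (forall w, w \in W -> exists v, argmin_set W mu v = [:: w]).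

(* The cell Q = Q_1 + ... + Q_n of S determined by the lower direction (v,1):
   recorded as the tuple of point sets whose convex hulls are the Q_i. *)
Definition mcell (W : 'I_n -> seq 'rV[R]_n) (mu : 'I_n -> 'rV[R]_n -> R)
  (v : 'rV[R]_n) : {ffun 'I_n -> seq 'rV[R]_n} :=
  [ffun i => argmin_set (W i) (mu i) v].

Definition mink_dim (C : {ffun 'I_n -> seq 'rV[R]_n}) : nat :=
  seq_rank (flatten [seq dirs (C i) | i <- enum 'I_n]).

Definition is_pure (W : 'I_n -> seq 'rV[R]_n) (mu : 'I_n -> 'rV[R]_n -> R) : Prop :=
  forall v, mink_dim (mcell W mu v) = (\sum_(i < n) affdim (mcell W mu v i))%N.

Definition is_mixed (C : {ffun 'I_n -> seq 'rV[R]_n}) : bool :=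
  (mink_dim C == n) && [forall i, affdim (C i) == 1%N].

Definition opp_endpoints (A : seq 'rV[R]_n) (s : 'rV[R]_n -> bool) : Prop :=
  exists a b, [/\ a \in A, b \in A, s a != s b &
    forall c, c \in A -> exists2 t : R, 0 <= t <= 1 & c = t *: a + (1 - t) *: b].

Definition is_nonempty_mixed (C : {ffun 'I_n -> seq 'rV[R]_n})
  (sigma : 'I_n -> 'rV[R]_n -> bool) : Prop :=
  is_mixed C /\ forall i, opp_endpoints (C i) (sigma i).

End MixedSubdivision.

(* Main.v *)
(** To a nonempty mixed cell with edges [a_i, b_i] attach the tensor
    [(x)_i (e_(a_i) + e_(b_i))] in [(x)_i R^(W_i)].  As [a_i] and [b_i] have
    opposite signs, the i-th factor lies in the hyperplane
    [sum_w sign_i(w) x_w = 0], so all these tensors lie in a space of dimension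
    [prod_i (|W_i| - 1)], and it suffices to see that they are independent.

    The tensor of [v] has a nonzero coordinate at [c] in [prod_i W_i] exactly
    when [v] lies in the convex region where every [c_i] is a minimizer.  For
    a generic linear form [L], every solution [v] is the unique minimum of
    [L] on exactly one of its [2^n] adjacent regions: [L] is a combination
    with nonzero coefficients of the edge directions at [v], and the signs of
    the coefficients select the region.  Ordering the cells by [L] then makes
    the coordinate matrix triangular. *)
Require Import Defs.
From HB Require Import structures.
From mathcomp Require Import all_boot all_order all_algebra.
From mathcomp Require Import lra.
Import Order.TTheory GRing.Theory Num.Theory.
Local Open Scope ring_scope.

(** * Generic linear forms *)

Lemma poly_nonroot (R : numDomainType) (p : {poly R}) :
  p != 0 -> exists x, ~~ root p x.
Proof.
move=> p0; pose s := [seq k%:R : R | k <- iota 0 (size p)].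
have us : uniq s by rewrite map_inj_uniq ?iota_uniq // => i j /eqP; rewrite eqr_nat => /eqP.
have [rs|] := boolP (all (root p) s).
  by have := max_poly_roots p0 rs us; rewrite size_map size_iota ltnn.
by case/allPn => x _ px; exists x.
Qed.

(* The vector is taken on the moment curve. *)
Lemma generic_row (R : numFieldType) (m n : nat) (D : 'I_m -> 'M[R]_n) :
  (forall k, D k \in unitmx) ->
  exists l : 'rV[R]_n, forall k i, (l *m invmx (D k)) 0 i != 0.
Proof.
move=> Du.
(* Column [i] of the inverse of [D k] read as a polynomial: its value at [x] is coordinate [i] of
   [(1, x, ..., x^(n-1))] times that inverse. *)
pose q k i : {poly R} := rVpoly (row i (invmx (D k))^T).
have q0 k i : q k i != 0.
  apply/eqP => /(congr1 (@poly_rV R n)); rewrite rVpolyK linear0 => ri0.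
  have : row_free (invmx (D k))^T by rewrite row_free_unit unitmx_tr unitmx_inv.
  move=> rf; have: delta_mx 0 i *m (invmx (D k))^T = 0 *m (invmx (D k))^T :> 'rV_n.
    by rewrite -rowE ri0 mul0mx.
  move/(row_free_inj rf)/matrixP/(_ 0 i)/eqP.
  by rewrite !mxE !eqxx oner_eq0.
have [|x px] := @poly_nonroot R (\prod_k \prod_i q k i).
  by apply/prodf_neq0 => k _; apply/prodf_neq0.
exists (\row_j x ^+ j) => k i; apply: contra px => /eqP e.
rewrite rootE horner_prod; apply/prodf_eq0; exists k => //.
rewrite horner_prod; apply/prodf_eq0; exists i => //.
rewrite /q /rVpoly horner_poly -[X in _ == X]e mxE; apply/eqP/eq_bigr => j _.
by rewrite insubT // => ltj; rewrite !mxE mulrC; congr (_ * invmx _ _ _); apply: val_inj.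
Qed.

(** * Independent tensors with factors in hyperplanes *)

Section ProductBound.
Set Implicit Arguments. Unset Strict Implicit.
Variables (R : realFieldType) (T : eqType) (m n : nat).
Variables (W : 'I_n -> seq T) (x : 'I_m -> 'I_n -> T -> R) (s : 'I_n -> T -> R).
Hypothesis s_neq0 : forall i w, s i w != 0.
Hypothesis x_hyperplane : forall k i, \sum_(w <- W i) s i w * x k i w = 0.

(* The hyperplane relation expresses the coordinate at the head of [W i]
   through the others. *)
Lemma tensor_relation_extend (y : 'I_m -> R) :
  (forall c : 'I_n -> T, (forall i, c i \in behead (W i)) ->
     \sum_k y k * \prod_i x k i (c i) = 0) ->
  forall c : 'I_n -> T, (forall i, c i \in W i) ->
     \sum_k y k * \prod_i x k i (c i) = 0.
Proof.
move=> y0.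
(* Induction on the number [l] of leading indices at which [c] may still take the head of [W i]. *)
suff H l : forall c : 'I_n -> T, (forall i, c i \in W i) ->
    (forall i : 'I_n, (l <= i)%N -> c i \in behead (W i)) ->
    \sum_k y k * \prod_i x k i (c i) = 0.
  by move=> c cW; apply: (H n) => // i; rewrite leqNgt ltn_ord.
elim: l => [|l IH] c cW ctl; first by apply: y0 => i; exact: ctl.
have [ltl|lel] := ltnP l n; last first.
  by apply: IH => // i /(leq_trans lel); rewrite leqNgt ltn_ord.
pose i := Ordinal ltl; pose upd w j := if j == i then w else c j.
have upd_prod k w : \prod_j x k j (upd w j) = x k i w * \prod_(j | j != i) x k j (c j).
  rewrite (bigD1 i) //= /upd eqxx; congr (_ * _).
  by apply: eq_bigr => j /negPf ->.
have updc j : upd (c i) j = c j by rewrite /upd; case: eqP => // ->.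
have rel : \sum_(w <- W i) s i w * (\sum_k y k * \prod_j x k j (upd w j)) = 0.
  under eq_bigr do rewrite mulr_sumr.
  rewrite exchange_big /= big1 // => k _.
  under eq_bigr => w _ do rewrite upd_prod (mulrCA (y k)) (mulrA (s i w)).
  by rewrite -mulr_suml x_hyperplane mul0r.
have upd0 w : w \in behead (W i) -> \sum_k y k * \prod_j x k j (upd w j) = 0.
  move=> wW; apply: IH => j; rewrite /upd.
    by case: eqP => [->|_]; [apply: mem_behead|exact: cW].
  case: eqP => [->//|/eqP ji lej]; apply: ctl.
  by rewrite ltn_neqAle lej andbT eq_sym.
under eq_bigr do under eq_bigr do rewrite -updc.
have := cW i; case EW : (W i) => [//|w0 W']; rewrite inE => /orP[/eqP ciw0|ciW].
  have tail0 : \sum_(w <- W') s i w * (\sum_k y k * \prod_j x k j (upd w j)) = 0.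
    by rewrite big_seq big1 // => w wW'; rewrite upd0 ?mulr0 // EW.
  move: rel; rewrite EW big_cons tail0 addr0 => /eqP.
  by rewrite mulf_eq0 (negPf (s_neq0 _ _)) /= ciw0 => /eqP.
by apply: upd0; rewrite EW.
Qed.

Variables (c : 'I_m -> 'I_n -> T) (L : 'I_m -> R).
Hypothesis c_in : forall k i, c k i \in W i.
Hypothesis c_diag : forall k i, x k i (c k i) != 0.
Hypothesis c_triangular : forall k k', k' != k ->
  (forall i, x k' i (c k i) != 0) -> L k < L k'.

(** Evaluate at the pivot [c k] of an index with [y k != 0] and [L k] maximal: any other surviving
    term would have larger [L]. *)
Lemma triangular_relation0 (y : 'I_m -> R) :
  (forall d : 'I_n -> T, (forall i, d i \in W i) ->
     \sum_k y k * \prod_i x k i (d i) = 0) ->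
  forall k, y k = 0.
Proof.
move=> y0 k0; apply/eqP/negPn/negP => yk0.
have [k yk kmax] : exists2 k, y k != 0 & forall k', y k' != 0 -> L k' <= L k.
  by case: (@arg_maxP _ _ _ k0 (fun k => y k != 0) L yk0) => k yk kmax; exists k.
suff rest0 : \sum_(k' | k' != k) y k' * \prod_i x k' i (c k i) = 0.
  have := y0 (c k) (c_in k); rewrite (bigD1 k) //= rest0 addr0 => /eqP.
  rewrite mulf_eq0 (negPf yk) /=.
  by apply/negP/prodf_neq0 => i _; exact: c_diag.
apply: big1 => k' k'k; have [->|yk'] := eqVneq (y k') 0; first by rewrite mul0r.
apply/eqP; rewrite mulf_eq0 (negPf yk') /= -[_ == 0]negbK; apply/negP => /prodf_neq0 nz.
by have := kmax _ yk'; rewrite leNgt c_triangular // => i; exact: nz.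
Qed.

Lemma triangular_hyperplane_bound : (m <= \prod_i (size (W i)).-1)%N.
Proof.
have [->//|m_gt0] := posnP m.
pose M := (\max_i size (W i)).+1.
pose F (i : 'I_n) : pred 'I_M := fun j => (j < (size (W i)).-1)%N.
(* The shift [.+1] skips the head of [W i]; for [f] in [family F] the default is never reached. *)
pose pt (f : {ffun 'I_n -> 'I_M}) i := nth (c (Ordinal m_gt0) i) (W i) (f i).+1.
have cardX : #|family F| = (\prod_i (size (W i)).-1)%N.
  rewrite card_family foldrE big_map big_enum /=.
  apply: eq_bigr => i _; have le_M : ((size (W i)).-1 <= M)%N.
    by apply: leq_trans (leq_pred _) _; apply: leqW; apply: (leq_bigmax i).
  rewrite -sum1_card -[RHS]card_ord -[RHS]sum1_card.
  by rewrite (big_ord_widen M (fun=> 1%N) le_M).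
pose B := \matrix_(k < m, j < #|family F|) \prod_i x k i (pt (enum_val j) i).
rewrite -cardX; suff /eqP <- : row_free B by exact: rank_leq_col.
(* A vector killing [B] is a relation at the tuples avoiding listed heads, hence at all tuples. *)
apply: inj_row_free => y yB; apply/rowP => k; rewrite mxE.
apply: (@triangular_relation0 (y 0)); apply: tensor_relation_extend => d d_in.
have idx i : {j : 'I_M | (j < (size (W i)).-1)%N & nth (c (Ordinal m_gt0) i) (W i) j.+1 = d i}.
  have lt_idx : (index (d i) (behead (W i)) < (size (W i)).-1)%N.
    by rewrite -size_behead index_mem.
  have lt_M : (index (d i) (behead (W i)) < M)%N.
    apply: leq_trans lt_idx _; apply: leq_trans (leq_pred _) _.
    by apply: leqW; apply: (leq_bigmax i).
  by exists (Ordinal lt_M) => //=; rewrite -nth_behead nth_index.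
pose f := [ffun i => s2val (idx i)].
have fF : f \in family F by apply/familyP => i; rewrite ffunE; exact: s2valP (idx i).
have := congr1 (fun A : 'rV_ _ => A 0 (enum_rank_in fF f)) yB.
rewrite !mxE => yf0; rewrite -[RHS]yf0; apply: eq_bigr => k' _; rewrite mxE enum_rankK_in //.
by congr (_ * _); apply: eq_bigr => i _; rewrite /pt ffunE (s2valP' (idx i)).
Qed.
End ProductBound.

(** * Edges of mixed cells *)

Section Cells.
Set Implicit Arguments. Unset Strict Implicit.
Variables (R : realFieldType) (n : nat).
Implicit Types (W A : seq 'rV[R]_n) (u v w : 'rV[R]_n).

Lemma argmin_set_le W mu v w w' :
  w \in argmin_set W mu v -> w' \in W -> dotv v w + mu w <= dotv v w' + mu w'.
Proof. by rewrite mem_filter => /andP[/allP + _]; apply. Qed.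

(** Affine independence in dimension 1 leaves exactly two points, so none lies strictly inside the
    segment. *)
Lemma segment_endpoints A (s : 'rV[R]_n -> bool) :
  uniq A -> aff_indep A -> affdim A = 1%N -> opp_endpoints A s ->
  exists2 e : 'rV[R]_n * 'rV[R]_n, perm_eq A [:: e.1; e.2] & s e.1 != s e.2.
Proof.
move=> uA /eqP ai ad [a [b [aA bA sab _]]]; exists (a, b) => //=.
have szA : size A = 2%N by move: ai; rewrite ad; case: (size A) => [|[|[]]].
have uab : uniq [:: a; b] by rewrite /= inE andbT; apply: contraNneq sab => ->.
rewrite perm_sym; apply: uniq_perm => //.
have sub : {subset [:: a; b] <= A} by move=> w; rewrite !inE => /orP[] /eqP ->.
by have [] := uniq_min_size uab sub; rewrite ?szA.
Qed.

(** Each direction of [C i] is zero or, up to sign, the edge vector, so the rows span all that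
    [mink_dim] measures. *)
Lemma edge_matrix_unit (C : {ffun 'I_n -> seq 'rV[R]_n})
    (e : 'I_n -> 'rV[R]_n * 'rV[R]_n) :
  mink_dim C = n -> (forall i, perm_eq (C i) [:: (e i).1; (e i).2]) ->
  \matrix_i ((e i).2 - (e i).1) \in unitmx.
Proof.
move=> dimC Ce; set D := \matrix_i _.
rewrite -row_full_unit /row_full eqn_leq rank_leq_col -{1}dimC /mink_dim /seq_rank.
apply/mxrankS/row_subP => j; rewrite rowK.
have /flattenP[_ /mapP[i _ ->] /mapP[p pC ->]] := mem_nth 0 (ltn_ord j).
have De : ((e i).2 - (e i).1 <= D)%MS by rewrite -(rowK (fun i => (e i).2 - (e i).1)) row_sub.
have hC : head 0 (C i) \in C i by case: (C i) pC => //= h t _; exact: mem_head.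
move: pC hC; rewrite !(perm_mem (Ce i)) !inE.
case/orP => /eqP-> /orP[] /eqP->; rewrite ?subrr ?sub0mx //.
by rewrite -opprB eqmx_opp.
Qed.

Lemma dotvE u v : dotv u v = (u *m v^T) 0 0.
Proof. by rewrite mxE; apply: eq_bigr => j _; rewrite mxE. Qed.

Lemma dotvBl u u' v : dotv (u - u') v = dotv u v - dotv u' v.
Proof. by rewrite !dotvE mulmxBl [LHS]mxE [X in _ + X]mxE. Qed.

Lemma dotvBr u v v' : dotv u (v - v') = dotv u v - dotv u v'.
Proof. by rewrite !dotvE linearB mulmxBr [LHS]mxE [X in _ + X]mxE. Qed.

End Cells.

(* T(W_1,...,W_n) <= prod (|W_i| - 1): for every admissible (mu, sigma), any
   list of lower directions producing pairwise distinct nonempty mixed cells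
   has length at most prod (|W_i| - 1). Signs: true = +1, false = -1. *)
Theorem theorem1p6 (R : realFieldType) (n : nat)
  (W : 'I_n -> seq 'rV[R]_n)
  (W_nonempty : forall i, W i != [::])
  (W_uniq : forall i, uniq (W i))
  (mu : 'I_n -> 'rV[R]_n -> R) (sigma : 'I_n -> 'rV[R]_n -> bool)
  (tri : forall i, is_triangulation (W i) (mu i))
  (pure : is_pure W mu)
  (vs : seq 'rV[R]_n)
  (distinct : uniq [seq mcell W mu v | v <- vs])
  (nonempty_mixed : forall v, v \in vs -> is_nonempty_mixed (mcell W mu v) sigma) :
  (size vs <= \prod_(i < n) (size (W i)).-1)%N.
Proof.
pose v k := tnth (in_tuple vs) k.
pose A k i := argmin_set (W i) (mu i) (v k).
have v_inj : injective v by apply/tuple_uniqP; exact: map_uniq distinct.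
have AE k i : mcell W mu (v k) i = A k i by rewrite ffunE.
have mixed k : is_nonempty_mixed (mcell W mu (v k)) sigma.
  exact: nonempty_mixed (mem_tnth k (in_tuple vs)).
have edge k i : exists e : 'rV[R]_n * 'rV[R]_n,
    perm_eq (A k i) [:: e.1; e.2] /\ sigma i e.1 != sigma i e.2.
  have [/andP[_ /forallP/(_ i)/eqP]] := mixed k; rewrite AE => ad /(_ i).
  rewrite AE => /(segment_endpoints _ _ _).
  by case=> // [||e pe se]; [exact: filter_uniq|exact: (tri i).1|exists e].
have [e eP] := fin_all_exists (fun k => fin_all_exists (edge k)).
pose D k := \matrix_i ((e k i).2 - (e k i).1).
have Du k : D k \in unitmx.
  have [/andP[/eqP dimC _] _] := mixed k.
  by apply: edge_matrix_unit dimC _ => i; rewrite AE (eP k i).1.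
have [l l_generic] := generic_row _ _ _ D Du.
(* The coordinates of [l] in the basis of edge vectors at [v k]; their signs choose the pivot
   endpoints. *)
pose lam k := l *m invmx (D k).
pose c k i := if 0 < lam k 0 i then (e k i).1 else (e k i).2.
have memA k i w : (w \in A k i) = (w == (e k i).1) || (w == (e k i).2).
  by rewrite (perm_mem (eP k i).1) !inE.
have e1A k i : (e k i).1 \in A k i by rewrite memA eqxx.
have e2A k i : (e k i).2 \in A k i by rewrite memA eqxx orbT.
have cA k i : c k i \in A k i by rewrite /c; case: ifP.
have AW k i w : w \in A k i -> w \in W i by rewrite mem_filter => /andP[].
(* Here [true] gives -1; only the opposition of the two signs matters. *)
apply: (@triangular_hyperplane_bound R _ _ _ W (fun k i w => (w \in A k i)%:R)
          (fun i w => (-1) ^+ sigma i w) _ _ c (fun k => dotv l (v k))).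
- by move=> i w; rewrite signr_eq0.
- move=> k i.
  rewrite (eq_big_seq (fun w => if w \in A k i then (-1) ^+ sigma i w else 0)); last first.
    by move=> w _; case: ifP => _; rewrite (mulr1, mulr0).
  rewrite -big_mkcond -big_filter (perm_big [:: (e k i).1; (e k i).2]).
    rewrite big_cons big_seq1; have := (eP k i).2.
    by case: (sigma i _); case: (sigma i _) => //= _; rewrite ?addNr ?subrr.
  apply: perm_trans (eP k i).1; apply: uniq_perm; rewrite ?filter_uniq // => w.
  by rewrite mem_filter andb_idr //; exact: AW.
- by move=> k i; apply: AW.
- by move=> k i; rewrite cA oner_eq0.
move=> k k' k'k cA'; have {}cA' i : c k i \in A k' i.
  by have := cA' i; case: (_ \in _) => //; rewrite eqxx.
(* The change, from [v k] to [v k'], of the gap between the lifted values of the endpoints. The gap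
   is 0 at [v k], and at [v k'] the chosen endpoint is minimal, so [z i] never opposes the sign of
   [lam k 0 i]. *)
pose z i := dotv (v k' - v k) ((e k i).2 - (e k i).1).
have dot_diff : dotv l (v k') - dotv l (v k) = \sum_i lam k 0 i * z i.
  have -> : dotv l (v k') - dotv l (v k) = (lam k *m (D k *m (v k' - v k)^T)) 0 0.
    by rewrite mulmxA mulmxKV // -dotvE dotvBr.
  rewrite mxE; apply: eq_bigr => i _; congr (_ * _).
  by rewrite mxE; apply: eq_bigr => j _; rewrite !mxE mulrC.
have term_ge0 i : 0 <= lam k 0 i * z i.
  have zE : z i = (dotv (v k') (e k i).2 - dotv (v k') (e k i).1)
                - (dotv (v k) (e k i).2 - dotv (v k) (e k i).1).
    by rewrite /z dotvBr !dotvBl; lra.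
  have eq12 : dotv (v k) (e k i).1 + mu i (e k i).1
            = dotv (v k) (e k i).2 + mu i (e k i).2.
    by apply/le_anti; rewrite !(@argmin_set_le _ _ (W i)) // (AW k).
  have := cA' i; rewrite /c; case: ltrP => [lam0 ceA|lam0 ceA].
    have := argmin_set_le ceA (AW k i _ (e2A k i)) => le12.
    apply: mulr_ge0; [exact: ltW|rewrite zE; lra].
  have := argmin_set_le ceA (AW k i _ (e1A k i)) => le21.
  apply: mulr_le0 => //; rewrite zE; lra.
rewrite -subr_gt0 dot_diff lt_neqAle sumr_ge0 // andbT eq_sym.
(* If equality held, every [z i] would vanish by genericity of [l], and invertibility of [D k] would
   give [v k' = v k]. *)
apply: contra k'k => /eqP /(psumr_eq0P (fun i _ => term_ge0 i)) sum0.
apply/eqP/v_inj/eqP; rewrite -subr_eq0 -trmx_eq0.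
have : D k *m (v k' - v k)^T = 0.
  apply/colP => i; rewrite [RHS]mxE; have /eqP := sum0 i isT.
  rewrite mulf_eq0 (negPf (l_generic k i)) /= => /eqP <-.
  by rewrite mxE; apply: eq_bigr => j _; rewrite !mxE mulrC.
by move/(congr1 (mulmx (invmx (D k)))); rewrite mulKmx // mulmx0 => ->.
Qed.
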